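(* Let $w \in S_n$. Then $\operatorname{Grid}(w)$ admits exactly one complete non-attacking rook placement if and only if $w$ is the union of an increasing subsequence and a decreasing subsequence that overlap.
   Context: For a permutation $w \in S_n$, $\operatorname{Grid}(w)$ is the $n\times n$ array of squares in which the squares in (row, column) positions $(i, w(i))$, $i = 1,\dots,n$, are black and all other squares are white. An across word is a maximal (non-empty) contiguous sequence of white squares within a single row; a down word is a maximal (non-empty) contiguous sequence of white squares within a single column. A complete non-attacking rook placement on a grid is a subset of its white squares containing exactly one square of every across word and exactly one square of every down word. Saying that $w$ is the union of an increasing subsequence and a decreasing subsequence that overlap means: there are a (strictly) increasing subsequence and a (strictly) decreasing subsequence of the one-line notation $w(1)\, w(2) \cdots w(n)$ such that every entry of $w$ belongs to at least one of them and some entry belongs to both. *)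

(* Defs.v *)
From mathcomp Require Import all_boot all_fingroup.

Set Implicit Arguments.
Unset Strict Implicit.
Unset Printing Implicit Defensive.

(* Squares are pairs (row, column); rows, columns and the values of a
   permutation are numbered from 0. *)
Definition white_squares (n : nat) (w : 'S_n) : {set 'I_n * 'I_n} :=
  [set x : 'I_n * 'I_n | x.2 != w x.1].

(* The segment between a and b, both ends included; nonempty iff a <= b. *)
Definition row_segment (n : nat) (i a b : 'I_n) : {set 'I_n * 'I_n} :=
  [set x : 'I_n * 'I_n | (x.1 == i) && (a <= x.2 <= b)].

Definition col_segment (n : nat) (j a b : 'I_n) : {set 'I_n * 'I_n} :=
  [set x : 'I_n * 'I_n | (x.2 == j) && (a <= x.1 <= b)].

Definition white_row_segment (n : nat) (w : 'S_n) (A : {set 'I_n * 'I_n})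
    : bool :=
  [exists i : 'I_n, exists a : 'I_n, exists b : 'I_n,
    (a <= b) && (A == row_segment i a b)] && (A \subset white_squares w).

Definition white_col_segment (n : nat) (w : 'S_n) (A : {set 'I_n * 'I_n})
    : bool :=
  [exists j : 'I_n, exists a : 'I_n, exists b : 'I_n,
    (a <= b) && (A == col_segment j a b)] && (A \subset white_squares w).

Definition across_word (n : nat) (w : 'S_n) (A : {set 'I_n * 'I_n}) : bool :=
  maxset (white_row_segment w) A.

Definition down_word (n : nat) (w : 'S_n) (A : {set 'I_n * 'I_n}) : bool :=
  maxset (white_col_segment w) A.

Definition complete_rook_placement (n : nat) (w : 'S_n)
    (R : {set 'I_n * 'I_n}) : Prop :=
  [/\ R \subset white_squares w,
      forall A, across_word w A -> #|R :&: A| = 1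
    & forall A, down_word w A -> #|R :&: A| = 1].

Definition one_line (n : nat) (w : 'S_n) : seq nat :=
  [seq val (w i) | i <- enum 'I_n].

Definition overlapping_union_inc_dec (n : nat) (w : 'S_n) : Prop :=
  exists s t : seq nat,
    [/\ subseq s (one_line w) /\ sorted ltn s,
        subseq t (one_line w) /\ sorted gtn t,
        forall x, x \in one_line w -> x \in s \/ x \in t
      & exists x, x \in s /\ x \in t].

(* Main.v *)
Require Import Defs.
From mathcomp Require Import all_boot all_fingroup.
From mathcomp Require Import zify.

Set Implicit Arguments.
Unset Strict Implicit.
Unset Printing Implicit Defensive.

(* Index columns by the row of their black square. A word is then one of the at
   most four rays (left, right, up, down) issued from a black square, and a
   placement is a perfect matching between horizontal and vertical rays.

   If the matching is unique, every nonempty set of its rooks contains one whose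
   down word misses the across words of the others. Removing such rooks one after
   another, the only down words that can come up are the ray up issued from just
   below the first row not yet used, matched in that row, and symmetrically at
   the bottom. All rows but one, k, get used, and the black squares
   between a row r and k then lie on one side of the black square of r: the
   permutation is an X centred at (k, w k).

   Conversely, in an X the ray up from row r + 1 <= k must be matched in row r,
   by induction on r, and likewise in the other three directions; these forced
   rooks already meet every word exactly once. *)

(** * Perfect matchings between two families of classes *)

(** Each element of [W] is an edge joining its [f]-class to its [g]-class. Injectivity gives at most
    one element of [R] per class, covering at least one. *)
Definition common_transversal (T : finType) (K L : eqType) (W : {set T})
    (f : T -> K) (g : T -> L) (R : {set T}) : Prop :=
  [/\ R \subset W, {in R &, injective f}, {in R &, injective g},
      {in W, forall z, exists2 x, x \in R & f x = f z}
    & {in W, forall z, exists2 x, x \in R & g x = g z}].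

(* If every rook of S had a square of its g-class in the f-class of another
   rook of S, following these squares would give an alternating cycle, along
   which R could be switched to a different transversal. *)
Lemma unique_transversal_leaf (T : finType) (K L : eqType) (W : {set T})
    (f : T -> K) (g : T -> L) (R S : {set T}) :
    common_transversal W f g R ->
    (forall R', common_transversal W f g R' -> R' = R) ->
    S \subset R -> S != set0 ->
  exists2 x, x \in S &
    forall y z, y \in S -> z \in W -> g z = g x -> f z = f y -> y = x.
Proof.
move=> [RW finj ginj fcov gcov] Runiq SR S0.
pose bad x (yz : T * T) :=
  [&& yz.1 \in S, yz.2 \in W, g yz.2 == g x, f yz.2 == f yz.1 & yz.1 != x].
have [/existsP[x /andP[xS /existsPn nbad]]|/existsPn allbad] :=
  boolP [exists x in S, ~~ [exists yz, bad x yz]].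
  exists x => // y z yS zW gz fz; apply/eqP; apply: contraT => yx.
  by have := nbad (y, z); rewrite /bad /= yS zW gz fz !eqxx yx.
(* The default [(x, x)] is never taken on [S], by [nextP]. *)
pose next x := odflt (x, x) [pick yz | bad x yz].
have nextP x : x \in S -> bad x (next x).
  move=> xS; rewrite /next; case: pickP => [//|nobad].
  have /existsP[yz] : [exists yz, bad x yz].
    by have := allbad x; rewrite xS negbK.
  by rewrite nobad.
pose h x := (next x).1.
pose closed (B : {set T}) := (B != set0) && (h @: B \subset B).
have Sclosed : closed S.
  rewrite /closed S0; apply/subsetP => _ /imsetP[x xS ->].
  by case/and5P: (nextP x xS).
(* By minimality [h] permutes [O], so following [next] inside [O] runs along alternating cycles. *)
have [O /minsetP[/andP[O0 hO] Omin] OS] := minset_exists Sclosed.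
have hOO : h @: O = O.
  apply: Omin => //; rewrite /closed imsetS // andbT.
  by have [x xO] := set0Pn _ O0; apply/set0Pn; exists (h x); apply: imset_f.
have hinj : {in O &, injective h} by apply/imset_injP; rewrite hOO.
have nextO x : x \in O -> bad x (next x) by move/(subsetP OS); apply: nextP.
(* [sw x] keeps the [g]-class of [x] and takes the [f]-class of [hR x]; since [hR] permutes [R], the
   switched set is again a transversal. *)
pose sw x := if x \in O then (next x).2 else x.
pose hR x := if x \in O then h x else x.
have hRR x : x \in R -> hR x \in R.
  rewrite /hR; case: ifP => // xO _.
  by apply: (subsetP SR); case/and5P: (nextO x xO).
have hRinj : {in R &, injective hR}.
  move=> x y _ _; rewrite /hR; case: ifP => xO; case: ifP => yO //.
  - exact: hinj.
  - by move=> exy; rewrite -exy -hOO imset_f in yO.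
  - by move=> exy; rewrite exy -hOO imset_f in xO.
have hRsurj y : y \in R -> exists2 x, x \in R & y = hR x.
  have /eqP eR : hR @: R == R.
    rewrite eqEcard card_in_imset // leqnn andbT.
    by apply/subsetP => _ /imsetP[x xR ->]; apply: hRR.
  by rewrite -{1}eR => /imsetP.
have gsw x : x \in R -> g (sw x) = g x.
  by rewrite /sw; case: ifP => // xO _; case/and5P: (nextO x xO) => _ _ /eqP.
have fsw x : x \in R -> f (sw x) = f (hR x).
  by rewrite /sw /hR; case: ifP => // xO _; case/and5P: (nextO x xO) => _ _ _ /eqP.
have eqR : sw @: R = R.
  apply: Runiq; split.
  - apply/subsetP => _ /imsetP[x xR ->]; rewrite /sw; case: ifP => [xO|_].
      by case/and5P: (nextO x xO).
    exact: (subsetP RW).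
  - move=> _ _ /imsetP[x xR ->] /imsetP[y yR ->]; rewrite !fsw // => exy.
    by congr sw; apply: hRinj => //; apply: finj => //; apply: hRR.
  - move=> _ _ /imsetP[x xR ->] /imsetP[y yR ->]; rewrite !gsw // => exy.
    by congr sw; apply: ginj.
  - move=> z zW; have [y yR <-] := fcov z zW.
    by have [x xR ->] := hRsurj y yR; exists (sw x); rewrite ?fsw ?imset_f.
  - move=> z zW; have [y yR <-] := gcov z zW.
    by exists (sw y); rewrite ?gsw ?imset_f.
(* By uniqueness [sw x] lies in [R], so it equals both [x] (same [g]-class) and [h x] (same
   [f]-class), whereas [bad] requires [h x != x]. *)
have [x xO] := set0Pn _ O0.
have xR : x \in R by apply: (subsetP SR); apply: (subsetP OS).
have swR : sw x \in R by rewrite -eqR imset_f.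
have e1 : sw x = x by apply: ginj => //; apply: gsw.
have e2 : sw x = hR x by apply: finj => //; [apply: hRR | apply: fsw].
case/and5P: (nextO x xO) => _ _ _ _ /eqP[].
by rewrite -[RHS]e1 e2 /hR xO.
Qed.

(** * Words as rays, and placements as transversals *)

(* Stated for abstract coordinates u, v, with b the black square of each line,
   so that it applies to rows and to columns alike. *)
Lemma maxset_segmentP (n : nat) (T : finType) (u v : T -> 'I_n)
    (b : 'I_n -> 'I_n) (W : {set T}) (seg : 'I_n -> 'I_n -> 'I_n -> {set T}) :
    (forall i j, exists2 x, u x = i & v x = j) ->
    (forall x, (x \in W) = (v x != b (u x))) ->
    (forall i a c x, (x \in seg i a c) = (u x == i) && (a <= v x <= c)) ->
  forall A, maxset (fun A => [exists i : 'I_n, exists a : 'I_n, exists c : 'I_n,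
      (a <= c) && (A == seg i a c)] && (A \subset W)) A <->
    exists2 z, z \in W & A = [set x in W |
      (u x, v x < b (u x)) == (u z, v z < b (u z))].
Proof.
move=> uv_surj inW inseg A; set P := fun A : {set T} => _.
pose cls z := [set x in W | (u x, v x < b (u x)) == (u z, v z < b (u z))].
have sub_cls B z : P B -> z \in B -> B \subset cls z.
  case/andP=> /existsP[i /existsP[a /existsP[c /andP[_ /eqP->]]]] segW zB.
  apply/subsetP => x xB; rewrite inE (subsetP segW) //=.
  have := xB; have := zB; rewrite !inseg => /andP[/eqP uz zac] /andP[/eqP ux xac].
  rewrite xpair_eqE ux uz eqxx /=.
  (* The black square of the line is outside the white segment, which therefore stays on one side of
     it. *)
  have [y uy vy] := uv_surj i (b i).
  have : y \notin seg i a c.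
    apply: contraL (eqxx (v y)) => /(subsetP segW).
    by rewrite inW uy vy eqxx.
  rewrite inseg uy vy eqxx /=; lia.
have clsP z : z \in W -> P (cls z).
  move=> zW; apply/andP; split; last by apply/subsetP => x; rewrite inE => /andP[].
  have := zW; rewrite inW -val_eqE /= => zb.
  have lti : forall m, m < n -> exists o : 'I_n, o = m :> nat.
    by move=> m mn; exists (Ordinal mn).
  have bn := ltn_ord (b (u z)); have zn := ltn_ord (v z).
  have [a [c [ac eac]]] : exists a c : 'I_n, a <= c /\ forall j : 'I_n,
      (a <= j <= c) =
      ((j : nat) != b (u z)) && ((j < b (u z)) == (v z < b (u z))).
    have [lt|ge] := boolP (v z < b (u z)).
    - have [a ea] := lti 0 ltac:(lia).
      have [c ec] := lti (b (u z)).-1 ltac:(lia).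
      exists a, c; split=> [|j]; lia.
    - have [a ea] := lti (b (u z)).+1 ltac:(lia).
      have [c ec] := lti n.-1 ltac:(lia).
      exists a, c; split=> [|j]; first lia.
      by have := ltn_ord j; lia.
  apply/existsP; exists (u z); apply/existsP; exists a; apply/existsP; exists c.
  rewrite ac; apply/eqP/setP => x; rewrite inE inseg inW xpair_eqE eac -val_eqE.
  by case: (u x =P u z) => [->|] //=; rewrite andbF.
have clsz z : z \in W -> z \in cls z by move=> zW; rewrite inE zW /=.
split=> [/maxsetP[PA Amax]|[z zW ->]].
  have [z zA] : exists z, z \in A.
    case/andP: (PA) => /existsP[i /existsP[a /existsP[c /andP[ac /eqP->]]]] _.
    by have [z uz vz] := uv_surj i a; exists z; rewrite inseg uz vz eqxx leqnn ac.
  have zW : z \in W by case/andP: PA => _ /subsetP; apply.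
  by exists z => //; symmetry; apply: Amax; [apply: clsP | apply: sub_cls].
apply/maxsetP; split; first exact: clsP.
move=> B PB sB; apply/eqP; rewrite eqEsubset sB andbT.
by apply: sub_cls => //; apply: (subsetP sB); apply: clsz.
Qed.

(** The key names a ray: [true] means left of the black square here, and above it in [down_key]. *)
Definition across_key (n : nat) (w : 'S_n) (x : 'I_n * 'I_n) : 'I_n * bool :=
  (x.1, x.2 < w x.1).

Definition down_key (n : nat) (w : 'S_n) (x : 'I_n * 'I_n) : 'I_n * bool :=
  (x.2, x.1 < (w^-1)%g x.2).

Lemma across_wordP (n : nat) (w : 'S_n) (A : {set 'I_n * 'I_n}) :
  across_word w A <-> exists2 z, z \in white_squares w &
    A = [set x in white_squares w | across_key w x == across_key w z].
Proof.
apply: (maxset_segmentP (u := fst) (v := snd) (seg := @row_segment n)).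
- by move=> i j; exists (i, j).
- by move=> x; rewrite inE.
- by move=> i a c x; rewrite inE.
Qed.

Lemma down_wordP (n : nat) (w : 'S_n) (A : {set 'I_n * 'I_n}) :
  down_word w A <-> exists2 z, z \in white_squares w &
    A = [set x in white_squares w | down_key w x == down_key w z].
Proof.
apply: (maxset_segmentP (u := snd) (v := fst) (b := (w^-1)%g)
  (seg := @col_segment n)).
- by move=> i j; exists (j, i).
- by move=> x; rewrite inE -(inj_eq (@perm_inj _ w^-1)) permK eq_sym.
- by move=> i a c x; rewrite inE.
Qed.

Lemma card_transversalP (T : finType) (K : eqType) (W R : {set T}) (f : T -> K) :
    R \subset W ->
  (forall z, z \in W -> #|R :&: [set x in W | f x == f z]| = 1) <->
  ({in R &, injective f} /\ {in W, forall z, exists2 x, x \in R & f x = f z}).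
Proof.
move=> /subsetP RW; split=> [card1|[finj fcov] z zW].
  split=> [x y xR yR exy|z /card1/eqP/cards1P[x /setP/(_ x)]].
    have /eqP/cards1P[t /setP et] := card1 x (RW x xR).
    have := et x; have := et y; rewrite !inE xR yR !RW // exy eqxx /=.
    by move=> /esym/eqP-> /esym/eqP.
  rewrite !inE eqxx => /and3P[xR _ /eqP fx]; by exists x.
have [x xR fx] := fcov z zW; apply/eqP/cards1P; exists x; apply/setP => y.
rewrite !inE; apply/and3P/eqP => [[yR _ /eqP fy]|->].
  by apply: finj; rewrite // fy.
by rewrite xR RW // fx.
Qed.

Lemma complete_rook_placementP (n : nat) (w : 'S_n) (R : {set 'I_n * 'I_n}) :
  complete_rook_placement w R <->
  common_transversal (white_squares w) (across_key w) (down_key w) R.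
Proof.
split=> [[RW ac dn]|[RW finj ginj fcov gcov]].
  have [|finj fcov] := (card_transversalP (across_key w) RW).1.
    by move=> z zW; apply/ac/across_wordP; exists z.
  have [|ginj gcov] := (card_transversalP (down_key w) RW).1 => [z zW|].
    by apply/dn/down_wordP; exists z.
  by split.
split=> // A.
  case/across_wordP => z zW ->.
  exact: (card_transversalP _ RW).2 (conj finj fcov) z zW.
case/down_wordP => z zW ->.
exact: (card_transversalP _ RW).2 (conj ginj gcov) z zW.
Qed.

(** * Exchange of rows and columns *)

Definition transpose (n : nat) (x : 'I_n * 'I_n) : 'I_n * 'I_n := (x.2, x.1).

Lemma transposeK (n : nat) : involutive (@transpose n).
Proof. by case. Qed.

Lemma across_key_transpose (n : nat) (w : 'S_n) x :
  across_key w^-1 (transpose x) = down_key w x.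
Proof. by []. Qed.

Lemma down_key_transpose (n : nat) (w : 'S_n) x :
  down_key w^-1 (transpose x) = across_key w x.
Proof. by rewrite /down_key invgK. Qed.

Lemma white_transpose (n : nat) (w : 'S_n) x :
  (transpose x \in white_squares w^-1) = (x \in white_squares w).
Proof. by rewrite !inE -(inj_eq (@perm_inj _ w)) permKV eq_sym. Qed.

(** * The placement attached to a centre *)

(* The point (k, w k) is the centre of an X formed by the whole permutation:
   seen from any other row r, all the points in rows between r (excluded) and k
   (included) lie on the same side. *)
Definition is_center (n : nat) (w : 'S_n) (k : 'I_n) : Prop :=
  forall r i : 'I_n, (r < i <= k) || (k <= i < r) ->
    (w i < w r) = (w k < w r).

(** What is forbidden is a pair [r], [i] with [i] between [r] and [k] while [w r] is between [w i]
    and [w k]. Inversion only exchanges the roles of [r] and [i]. *)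
Lemma is_center_inv (n : nat) (w : 'S_n) (k : 'I_n) :
  is_center w k -> is_center w^-1 (w k).
Proof.
move=> cw c d; rewrite -[c](permKV w) -[d](permKV w) !permK.
move: (_ c) (_ d) => {c d} a b.
have w_ext (i j : 'I_n) : (w i = w j :> nat) <-> (i = j :> nat).
  by split=> [/val_inj/perm_inj->|/val_inj->].
have := cw a b; have := cw b a.
have := w_ext a b; have := w_ext a k; have := w_ext b k; lia.
Qed.

Definition toward (k a b : nat) : bool :=
  ((a < k) && (b == a.+1)) || ((k < a) && (a == b.+1)).

(** The forced rooks, of two kinds swapped by transposition: one in each row other than [k], one in
    each column other than [w k]. *)
Definition center_placement (n : nat) (w : 'S_n) (k : 'I_n) :
    {set 'I_n * 'I_n} :=
  [set x : 'I_n * 'I_n | toward k x.1 ((w^-1)%g x.2) || toward (w k) x.2 (w x.1)].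

Lemma center_placement_transpose (n : nat) (w : 'S_n) (k : 'I_n) x :
  (transpose x \in center_placement w^-1 (w k)) = (x \in center_placement w k).
Proof. by rewrite !inE /= invgK permK orbC. Qed.

Lemma exists_toward (n : nat) (k a : 'I_n) :
  a != k -> exists b : 'I_n, toward k a b.
Proof.
rewrite -val_eqE /= => ak; have an := ltn_ord a; have kn := ltn_ord k.
have [lt|ge] := boolP (a < k).
  by have bn : a.+1 < n by [lia]; exists (Ordinal bn); rewrite /toward /= lt eqxx.
have bn : a.-1 < n by lia.
by exists (Ordinal bn); rewrite /toward /=; lia.
Qed.

Lemma center_side (n : nat) (w : 'S_n) (k r r' : 'I_n) :
  is_center w k -> toward k r r' -> (w r' < w r) = (w k < w r).
Proof. by move=> cw tr; apply: cw; move: tr; rewrite /toward; lia. Qed.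

Lemma center_placement_white (n : nat) (w : 'S_n) (k : 'I_n) :
  center_placement w k \subset white_squares w.
Proof.
apply/subsetP => x; rewrite !inE /toward => xF; apply/eqP => ex.
by move: xF; rewrite ex permK; lia.
Qed.

(** In a row, a rook of the first kind is on the side of the centre column, by [center_side]; one of
    the second kind is next to the black square, on the far side. *)
Lemma center_placement_inj (n : nat) (w : 'S_n) (k : 'I_n) :
  is_center w k -> {in center_placement w k &, injective (across_key w)}.
Proof.
move=> cw.
have mixed (i c d : 'I_n) : toward k i ((w^-1)%g c) -> toward (w k) d (w i) ->
    (c < w i) = (d < w i) -> c = d.
  move=> tc td; have := center_side cw tc; rewrite permKV => -> side.
  have ik : w i = w k :> nat -> i = k :> nat by move=> /val_inj/perm_inj->.
  by exfalso; move: ik tc td side; rewrite /toward; lia.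
move=> [i c] [j d]; rewrite !inE /= => xF yF [eij].
rewrite -{j}eij in yF * => e; congr pair.
case/orP: xF => tc; case/orP: yF => td.
- apply: (@perm_inj _ w^-1); apply: val_inj => /=.
  by move: tc td; rewrite /toward; lia.
- exact: mixed tc td e.
- by symmetry; apply: mixed td tc _.
- by apply: val_inj => /=; move: tc td e; rewrite /toward; lia.
Qed.

Lemma center_placement_cover (n : nat) (w : 'S_n) (k : 'I_n) :
  is_center w k -> {in white_squares w, forall z,
    exists2 x, x \in center_placement w k & across_key w x = across_key w z}.
Proof.
move=> cw [i c]; rewrite inE /= -val_eqE /= => ciN.
have wn := ltn_ord (w i); have cn := ltn_ord c.
have [out|inn] := boolP ((c < w i) == (w k < w i)).
  (* For [i = k] the test [w k < w i] is false, so this branch is the ray to the right of the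
     centre; the left ray falls under [inn]. *)
  have [eik|/exists_toward[i' ti]] := eqVneq i k.
    subst i; have dn : (w k).+1 < n by lia.
    exists (k, Ordinal dn); first by rewrite inE /toward /=; lia.
    by rewrite /across_key /=; congr pair; lia.
  exists (i, w i'); first by rewrite inE /= permK ti.
  by rewrite /across_key /= (center_side cw ti) (eqP out).
have [lt|ge] := boolP (c < w i).
  have dn : (w i).-1 < n by lia.
  exists (i, Ordinal dn); first by rewrite inE /toward /=; lia.
  by rewrite /across_key /=; congr pair; lia.
have dn : (w i).+1 < n by lia.
exists (i, Ordinal dn); first by rewrite inE /toward /=; lia.
by rewrite /across_key /=; congr pair; lia.
Qed.

Lemma center_placement_transversal (n : nat) (w : 'S_n) (k : 'I_n) :
  is_center w k -> common_transversal (white_squares w) (across_key w)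
    (down_key w) (center_placement w k).
Proof.
move=> cw; have cw' := is_center_inv cw; split.
- exact: center_placement_white.
- exact: center_placement_inj.
- move=> x y xF yF e; apply: (can_inj (@transposeK n)).
  by apply: (center_placement_inj cw'); rewrite ?center_placement_transpose.
- exact: center_placement_cover.
- move=> z zW; have [|x xF e] := center_placement_cover cw' (_ : transpose z \in _).
    by rewrite white_transpose.
  exists (transpose x); first by rewrite -center_placement_transpose transposeK.
  by rewrite -across_key_transpose transposeK.
Qed.

(** * A centre forces the placement *)

(** If the down word of [(r, w r')] were met in another row [q], then [q] would be farther from [k],
    and its rook [(q, w q')], known by induction, would share an across word with [(q, w r')]. *)
Lemma center_forced (n : nat) (w : 'S_n) (k : 'I_n) (R : {set 'I_n * 'I_n}) :
    is_center w k ->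
    common_transversal (white_squares w) (across_key w) (down_key w) R ->
  forall r r' : 'I_n, toward k r r' -> (r, w r') \in R.
Proof.
move=> cw [RW finj _ _ gcov] r r'.
(* The measure decreases as the row moves away from [k], on either side. *)
have [m] := ubnP (if r < k then nat_of_ord r else n - r).
elim: m r r' => // m IHm r r' rm tr.
have zW : (r, w r') \in white_squares w.
  by rewrite inE /= (inj_eq (@perm_inj _ w)) -val_eqE; move: tr; rewrite /toward /=; lia.
have [[q c] qR [/= ec side]] := gcov _ zW.
rewrite {c}ec permK in qR side *.
have qn := ltn_ord q; have rn := ltn_ord r.
have [<- //|/eqP qr] := eqVneq q r.
have {}qr : q <> r :> nat by move/val_inj.
have qr' : q <> r' :> nat.
  by move/val_inj => e; have := subsetP RW _ qR; rewrite inE /= e eqxx.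
have [q' tq] : exists q' : 'I_n, toward k q q'.
  apply: exists_toward; apply/eqP => eqk.
  by subst q; move: tr side qr qr'; rewrite /toward; lia.
have q'R : (q, w q') \in R.
  by apply: IHm tq; move: tr rm side qr qr'; rewrite /toward; do 2 case: ifP; lia.
have : (q, w r') = (q, w q').
  apply: finj => //; rewrite /across_key /= (center_side cw tq); congr pair.
  by apply: cw; move: tr side qr qr'; rewrite /toward; lia.
by case=> /perm_inj e; move: tr tq side qr qr'; rewrite -e /toward; lia.
Qed.

Lemma common_transversal_transpose (n : nat) (w : 'S_n) (R : {set 'I_n * 'I_n}) :
  common_transversal (white_squares w) (across_key w) (down_key w) R ->
  common_transversal (white_squares w^-1) (across_key w^-1) (down_key w^-1)
    (@transpose n @^-1: R).
Proof.
case=> RW finj ginj fcov gcov; split.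
- by apply/subsetP => x; rewrite inE => /(subsetP RW); rewrite -white_transpose transposeK.
- move=> x y; rewrite !inE => xR yR e; apply: (can_inj (@transposeK n)).
  by apply: ginj => //; rewrite -!across_key_transpose !transposeK.
- move=> x y; rewrite !inE => xR yR e; apply: (can_inj (@transposeK n)).
  by apply: finj => //; rewrite -!down_key_transpose !transposeK.
- move=> z; rewrite -{1}[z]transposeK white_transpose => /gcov[x xR e].
  by exists (transpose x); rewrite ?inE ?transposeK // across_key_transpose e
    -across_key_transpose transposeK.
- move=> z; rewrite -{1}[z]transposeK white_transpose => /fcov[x xR e].
  by exists (transpose x); rewrite ?inE ?transposeK // down_key_transpose e
    -down_key_transpose transposeK.
Qed.

Lemma center_unique (n : nat) (w : 'S_n) (k : 'I_n) (R : {set 'I_n * 'I_n}) :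
    is_center w k ->
    common_transversal (white_squares w) (across_key w) (down_key w) R ->
  R = center_placement w k.
Proof.
move=> cw tR; have FR : center_placement w k \subset R.
  apply/subsetP => -[i c]; rewrite inE /= => /orP[ti|tc].
    by have := center_forced cw tR ti; rewrite permKV.
  have := center_forced (is_center_inv cw) (common_transversal_transpose tR)
    (_ : toward (w k) c (w i)).
  by rewrite permK inE; apply.
(* The forced rooks already meet every across word, which leaves no room for another one. *)
apply/eqP; rewrite eqEsubset FR andbT; apply/subsetP => x xR.
case: tR => RW finj _ _ _.
have [y yF e] := center_placement_cover cw (subsetP RW x xR).
by rewrite -(finj y x) // (subsetP FR).
Qed.

(** * From uniqueness to a centre, by peeling rows *)

(* R has been peeled down to the rows a, ..., b: every other row r has a rook in
   the column of the black square of the neighbouring row towards [a, b], and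
   all the black squares in rows between r and [a, b] lie on the same side. *)
Definition peeled (n : nat) (w : 'S_n) (R : {set 'I_n * 'I_n}) (a b : nat) :=
  (forall r r' : 'I_n, r < a -> r' = r.+1 :> nat ->
    (r, w r') \in R /\
    forall i : 'I_n, r < i <= a -> (w i < w r) = (w r' < w r)) /\
  (forall r r' : 'I_n, b < r -> r = r'.+1 :> nat ->
    (r, w r') \in R /\
    forall i : 'I_n, b <= i < r -> (w i < w r) = (w r' < w r)).

(** A leaf [(q, w m)] among the rooks not yet peeled has [q] as the only row of [[a, b]] on its side
    of [m]. So [q] is an end of the interval and [m] its inner neighbour, and row [q] can be
    peeled. *)
Lemma peeled_step (n : nat) (w : 'S_n) (R : {set 'I_n * 'I_n}) (a b : nat) :
    common_transversal (white_squares w) (across_key w) (down_key w) R ->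
    (forall R', common_transversal (white_squares w) (across_key w)
       (down_key w) R' -> R' = R) ->
    a < b < n -> peeled w R a b ->
  peeled w R a.+1 b \/ peeled w R a b.-1.
Proof.
move=> tR Runiq /andP[ab bn] [top bot].
have [RW finj ginj fcov gcov] := tR.
have white (r m : 'I_n) : r <> m :> nat -> (r, w m) \in white_squares w.
  by move=> rm; rewrite inE /=; apply/eqP => /perm_inj e; case: rm; rewrite e.
have dkey (q m r : 'I_n) : (q < m) = (r < m) ->
  down_key w (q, w m) = down_key w (r, w m).
  by rewrite /down_key /= permK => ->.
pose S := [set x in R | ~~ ((x.1 < a) && ((w^-1)%g x.2 == x.1.+1 :> nat) ||
                          (b < x.1) && (x.1 == ((w^-1)%g x.2).+1 :> nat))].
have inS (r m : 'I_n) : ((r, w m) \in S) = ((r, w m) \in R) &&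
    ~~ ((r < a) && (m == r.+1 :> nat) || (b < r) && (r == m.+1 :> nat)).
  by rewrite inE /= permK.
have an : a < n by lia.
have a1n : a.+1 < n by lia.
(* The rook on the ray up from row [a.+1] remains: one peeled at the top is in the column of a row
   at most [a], one peeled at the bottom is in a row below [b]. *)
have S0 : S != set0.
  have neq : Ordinal an <> Ordinal a1n :> nat by rewrite /=; lia.
  have [[q c] qR [/= ec side]] := gcov _ (white _ _ neq).
  rewrite {c}ec permK /= in qR side *.
  by apply/set0Pn; exists (q, w (Ordinal a1n)); rewrite inS qR /=; lia.
have SR : S \subset R by apply/subsetP => x; rewrite inE => /andP[].
have [[q c] qS leaf] := unique_transversal_leaf tR Runiq SR S0.
have [m ec] : exists m, c = w m by exists ((w^-1)%g c); rewrite permKV.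
subst c.
have := qS; rewrite inS => /andP[qR qout].
have qm : q <> m :> nat.
  by move/val_inj => e; have := subsetP RW _ qR; rewrite inE /= e eqxx.
(* The square [(r, w m)] is in the leaf's down word, so the rook of its across word is not in [S]:
   it was peeled. *)
have across (r : 'I_n) : (r < m) = (q < m) -> r <> m :> nat -> r <> q :> nat ->
    exists m' : 'I_n, [/\ (r, w m') \in R, (w m' < w r) = (w m < w r) &
      (r < a) && (m' == r.+1 :> nat) || (b < r) && (r == m'.+1 :> nat)].
  move=> side rm rq; have zW := white _ _ rm.
  have [[r0 c] yR [/= er yside]] := fcov _ zW.
  have [m' ec] : exists m', c = w m' by exists ((w^-1)%g c); rewrite permKV.
  subst r0 c; exists m'; split=> //; apply/idPn => yout.
  have yS : (r, w m') \in S by rewrite inS yR.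
  have [e _] : (r, w m') = (q, w m).
    apply: (leaf _ (r, w m)) => //; first exact: dkey.
    by rewrite /across_key /= yside.
  by apply: rq; rewrite e.
have inner (r : 'I_n) : a <= r <= b -> (r < m) = (q < m) -> r <> m :> nat ->
    r = q :> nat.
  move=> rab side rm; apply/eqP/idPn => /eqP /across-/(_ side rm)[m' [_ _]].
  by lia.
have [lt|gt] := boolP (q < m).
  left; have am : a < m.
    have [//|ma] := ltnP a m.
    have m1n : m.-1 < n by have := ltn_ord m; lia.
    have [||rR _] := top (Ordinal m1n) m _ _; rewrite /=; [lia|lia|].
    have [e] : (Ordinal m1n, w m) = (q, w m).
      by apply: ginj => //; apply: dkey => /=; lia.
    by move: qout; rewrite -e /=; lia.
  have qa : a = q by apply: (inner (Ordinal an)) => /=; lia.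
  have ma : m = a.+1 :> nat.
    apply/eqP/idPn => ma.
    by have := inner (Ordinal a1n); rewrite /=; lia.
  split=> [r r' ra er'|//].
  (* For rows peeled earlier, only the new point [i = m] is to be checked; [across] puts it on the
     side of the peeled rook. *)
  have [rlt|req] : r < a \/ r = a :> nat by lia.
    have [rR side] := top r r' rlt er'; split=> // i ri.
    have [ia|ia] : i <= a \/ i = m :> nat by lia.
      by apply: side; lia.
    have [|||m' [_ e out]] := across r; try lia.
    by rewrite (val_inj ia) -e; have -> : m' = r' by apply: val_inj => /=; lia.
  have -> : r = q by apply: val_inj => /=; lia.
  have -> : r' = m by apply: val_inj => /=; lia.
  by split=> // i im; have -> : i = m by apply: val_inj => /=; lia.
right; have mb : m < b.
  have [//|bm] := ltnP m b.
  have m1n : m.+1 < n by have := ltn_ord q; lia.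
  have [||rR _] := bot (Ordinal m1n) m _ _; rewrite /=; [lia|lia|].
  have [e] : (Ordinal m1n, w m) = (q, w m).
    by apply: ginj => //; apply: dkey => /=; lia.
  by move: qout; rewrite -e /=; lia.
have qb : b = q by apply: (inner (Ordinal bn)) => /=; lia.
have b1n : b.-1 < n by lia.
have mb1 : m = b.-1 :> nat.
  apply/eqP/idPn => mb'.
  by have := inner (Ordinal b1n); rewrite /=; lia.
split=> [//|r r' rb er'].
have [rgt|req] : b < r \/ r = b :> nat by lia.
  have [rR side] := bot r r' rgt er'; split=> // i ri.
  have [ib|ib] : b <= i \/ i = m :> nat by lia.
    by apply: side; lia.
  have [|||m' [_ e out]] := across r; try lia.
  by rewrite (val_inj ib) -e; have -> : m' = r' by apply: val_inj => /=; lia.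
have -> : r = q by apply: val_inj => /=; lia.
have -> : r' = m by apply: val_inj => /=; lia.
by split=> // i im; have -> : i = m by apply: val_inj => /=; lia.
Qed.

(** Starting from all rows, [n.-1] peelings leave a single row, which is the centre. *)
Lemma unique_is_center (n : nat) (w : 'S_n) (R : {set 'I_n * 'I_n}) :
    0 < n ->
    common_transversal (white_squares w) (across_key w) (down_key w) R ->
    (forall R', common_transversal (white_squares w) (across_key w)
       (down_key w) R' -> R' = R) ->
  exists k : 'I_n, is_center w k.
Proof.
move=> n0 tR Runiq.
have peel d : d < n -> exists a b, [/\ a + (n.-1 - d) = b, b < n & peeled w R a b].
  elim: d => [|d IHd] dn.
    exists 0, n.-1; split; [lia | lia | split=> r r' //].
    by have := ltn_ord r; lia.
  have [a [b [eb bn pab]]] := IHd ltac:(lia).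
  have [||p|p] := peeled_step tR Runiq (a := a) (b := b) => //; first by lia.
    by exists a.+1, b; split=> //; lia.
  by exists a, b.-1; split=> //; lia.
have [a [b [eb bn [top bot]]]] := peel n.-1 ltac:(lia).
have {eb} ea : a = b by lia.
subst b; exists (Ordinal bn) => r i /=.
case/orP=> ria.
  have r1n : r.+1 < n by have := ltn_ord i; lia.
  have [||_ side] := top r (Ordinal r1n); [lia|by []|].
  by rewrite (side (Ordinal bn)) ?side //=; lia.
have r1n : r.-1 < n by have := ltn_ord r; lia.
have [||_ side] := bot r (Ordinal r1n); rewrite /=; [lia|lia|].
by rewrite (side (Ordinal bn)) ?side //=; lia.
Qed.

(** * Centres and monotone subsequences *)

Lemma pairwise_filter_imply (T : Type) (a : pred T) (r : rel T) (s : seq T) :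
  pairwise r (filter a s) = pairwise (fun x y => a x && a y ==> r x y) s.
Proof.
elim: s => //= x s <-; case: (a x) => /=; last by rewrite all_predT.
by rewrite all_filter.
Qed.

Lemma pairwise_enum_ord (n : nat) (r : rel 'I_n) :
  pairwise r (enum 'I_n) <-> forall i j : 'I_n, i < j -> r i j.
Proof.
split=> [|rij].
  case: n r => [|n] r; first by move=> _ [].
  move=> /(pairwiseP ord0) rP i j ij.
  have := rP i j; rewrite !inE size_enum_ord !nth_ord_enum.
  by apply; rewrite ?ltn_ord.
case: n r rij => [|n] r rij; first by rewrite (size0nil (size_enum_ord 0)).
apply/(pairwiseP ord0) => i j; rewrite !inE size_enum_ord => ilt jlt ij.
by apply: rij; rewrite !nth_enum_ord.
Qed.

Lemma mem_one_line (n : nat) (w : 'S_n) x :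
  reflect (exists i, x = w i :> nat) (x \in one_line w).
Proof.
apply: (iffP mapP) => [[i _ ->]|[i ->]]; first by exists i.
by exists i; rewrite ?mem_enum.
Qed.

Lemma one_line_uniq (n : nat) (w : 'S_n) : uniq (one_line w).
Proof. by rewrite map_inj_uniq ?enum_uniq // => i j /val_inj/perm_inj. Qed.

Lemma sorted_subseq_one_line (n : nat) (w : 'S_n) (r : rel nat) (s : seq nat) :
    transitive r -> subseq s (one_line w) -> sorted r s ->
  forall i j : 'I_n, i < j -> val (w i) \in s -> val (w j) \in s -> r (w i) (w j).
Proof.
(* Entries being distinct, [s] is the filter of [one_line w] by membership in [s]. *)
move=> r_tr /(subseq_uniqP (one_line_uniq w)) {1}->.
rewrite sorted_pairwise // pairwise_filter_imply pairwise_map.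
by move=> /pairwise_enum_ord rP i j /rP /= + si sj; rewrite si sj.
Qed.

Lemma sorted_one_line_filter (n : nat) (w : 'S_n) (r : rel nat) (a : pred 'I_n) :
    (forall i j : 'I_n, i < j -> a i -> a j -> r (w i) (w j)) ->
  sorted r [seq val (w i) | i <- enum 'I_n & a i].
Proof.
move=> ra; apply: pairwise_sorted.
rewrite pairwise_map pairwise_filter_imply; apply/pairwise_enum_ord => i j ij.
by apply/implyP => /andP[ai aj]; apply: ra.
Qed.

(** The shared entry is the value at the centre. Conversely, two opposite quadrants around the
    centre, together with it, form each subsequence. *)
Lemma overlapping_union_is_center (n : nat) (w : 'S_n) :
  overlapping_union_inc_dec w <-> exists k : 'I_n, is_center w k.
Proof.
split=> [[s [t [[ss s_inc] [st t_dec] cover [x [xs xt]]]]]|[k cw]].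
  have /mem_one_line[k ek] : x \in one_line w by exact: mem_subseq ss _ xs.
  have inc := sorted_subseq_one_line ltn_trans ss s_inc.
  have dec := sorted_subseq_one_line (rev_trans ltn_trans) st t_dec.
  subst x; exists k.
  have inst (i : 'I_n) : val (w i) \in s \/ val (w i) \in t.
    by apply/cover/mem_one_line; exists i.
  move=> r i; have := inst i; have := inst r.
  have [-> //|ik] := eqVneq i k.
  have := inc r i; have := inc i r; have := inc r k; have := inc k r.
  have := inc i k; have := inc k i; have := dec r i; have := dec i r.
  have := dec r k; have := dec k r; have := dec i k; have := dec k i.
  rewrite -val_eqE in ik; rewrite xs xt /= in ik *; lia.
have w_inj (i j : 'I_n) : w i = w j :> nat -> i = j :> nat.
  by move=> /val_inj/perm_inj->.
pose inc (i : 'I_n) := (i == k) || ((i < k) == (w i < w k)).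
pose dec (i : 'I_n) := (i == k) || ((i < k) == (w k < w i)).
have sub (a : pred 'I_n) : subseq [seq val (w i) | i <- enum 'I_n & a i] (one_line w).
  by apply/map_subseq/filter_subseq.
have mem (a : pred 'I_n) i :
    a i -> val (w i) \in [seq val (w i) | i <- enum 'I_n & a i].
  by move=> ai; apply: map_f; rewrite mem_filter ai mem_enum.
exists [seq val (w i) | i <- enum 'I_n & inc i].
exists [seq val (w i) | i <- enum 'I_n & dec i]; split.
- split=> //; apply: sorted_one_line_filter => i j ij.
  rewrite /inc -!val_eqE /=; have := w_inj i j; have := cw i j; have := cw j i.
  have eqk (l : 'I_n) : l = k :> nat -> w l = w k :> nat by move/val_inj->.
  by have := eqk i; have := eqk j; have := w_inj j k; have := w_inj i k; lia.
- split=> //; apply: sorted_one_line_filter => i j ij.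
  rewrite /dec -!val_eqE /=; have := w_inj i j; have := cw i j; have := cw j i.
  have eqk (l : 'I_n) : l = k :> nat -> w l = w k :> nat by move/val_inj->.
  by have := eqk i; have := eqk j; have := w_inj j k; have := w_inj i k; lia.
- move=> _ /mem_one_line[i ->].
  have [|] : inc i \/ dec i.
    by rewrite /inc /dec -val_eqE /=; have := w_inj i k; lia.
  + by left; apply: mem.
  + by right; apply: mem.
- by exists (val (w k)); split; apply: mem; rewrite /inc /dec eqxx.
Qed.

Theorem theorem3p7 (n : nat) (hn : 0 < n) (w : 'S_n) :
  (exists! R : {set 'I_n * 'I_n}, complete_rook_placement w R) <->
  overlapping_union_inc_dec w.
Proof.
rewrite overlapping_union_is_center.
split=> [[R [/complete_rook_placementP tR Runiq]]|[k cw]].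
  apply: (unique_is_center hn tR) => R' /complete_rook_placementP/Runiq.
  by move->.
exists (center_placement w k); split.
  exact/complete_rook_placementP/center_placement_transversal.
by move=> R /complete_rook_placementP tR; rewrite (center_unique cw tR).
Qed.
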